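(* Let $R$ be a finite commutative local ring with identity of order $p^2$, with $p$ an odd prime. Then $g_R(\frac{p+1}{2})=2$ if $R$ is a field, and if $R$ is not a field we have $$g_R\big(\tfrac{p+1}{2}\big)=\begin{cases}2, & \text{if } p\equiv1\pmod4,\\ 3, & \text{if } p\equiv3\pmod4.\end{cases}$$
   Context: The Waring number $g_R(k)$ is the minimum $s\in\mathbb{N}$, if it exists, such that $x_1^k+\cdots+x_s^k=r$ has a solution in $R$ for every $r\in R$. *)

(* Defs.v *)
From mathcomp Require Import all_boot all_algebra.

Set Implicit Arguments.
Unset Strict Implicit.
Unset Printing Implicit Defensive.

Import GRing.Theory.
Local Open Scope ring_scope.

(* In the library, idealr_closed already requires the ideal to be proper. *)
Definition maximal_ideal (R : finComNzRingType) (M : {set R}) : Prop :=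
  idealr_closed M /\
  forall I : {set R}, idealr_closed I -> M \subset I -> I = M.

Definition local_ring (R : finComNzRingType) : Prop :=
  exists! M : {set R}, maximal_ideal M.

(* This does not use GRing.field_axiom, which is stated for a unitRingType:
   R carries no chosen inverse operation here. *)
Definition is_field (R : comNzRingType) : Prop :=
  forall x : R, x != 0 -> exists y : R, y * x = 1.

Definition sum_of_powers (R : comNzRingType) (k s : nat) : Prop :=
  forall r : R, exists x : 'I_s -> R, \sum_(i < s) x i ^+ k = r.

(* The Waring number is only defined when some s works, so it is encoded as
   the relation "g_R(k) exists and equals s". *)
Definition waring_number (R : comNzRingType) (k s : nat) : Prop :=
  sum_of_powers R k s /\ forall t : nat, sum_of_powers R k t -> (s <= t)%N.

(* Main.v *)
Require Import Defs.
From mathcomp Require Import all_boot all_algebra.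
From mathcomp Require Import all_fingroup all_solvable all_field.
From mathcomp Require Import zify ring.
From HB Require Import structures.

Set Implicit Arguments.
Unset Strict Implicit.
Unset Printing Implicit Defensive.

Import GRing.Theory.
Local Open Scope ring_scope.

(** Put k = (p+1)/2, so that 2k = p+1; everything rests on this identity.

    Suppose first that R is a field with p^2 elements. Its unit group is cyclic
    of order k * 2(p-1), so x is a k-th power as soon as x^(2p) = x^2
    ([finField_power]). Let f be the Frobenius automorphism, an involution.
    Every r is the sum of (r + f r)/2, fixed by f, and (r - f r)/2, negated by
    f; both satisfy (f x)^2 = x^2 and hence are k-th powers. One power is not
    enough because a generator of the unit group is not a k-th power
    ([waring_finField]).

    Suppose now that R is not a field, with maximal ideal M. Counting gives
    #|M| = p, from which R / M is the prime field and M^2 = 0 ([residue_map],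
    [maximal_ideal_sqr0]). Since 0 < k < p, Newton's method applies to
    X^k - r: an element r whose residue is a nonzero k-th power is itself a
    k-th power ([power_lift]). On the other hand the k-th power of an element
    of M vanishes, as k >= 2. It remains to compute in the prime field, where
    (a^k)^2 = a^(p+1) = a^2 and so a^k = a or a^k = -a.

    If p = 1 mod 4 then k is odd, every residue is a k-th power, and so is
    every unit of R. An element r of M is 1 + (r - 1), a sum of two unit
    powers, but it is not a power itself unless r = 0.

    If p = 3 mod 4 then k is even, and a^k + b^k = 0 forces a = b = 0
    ([Fp_even_power_anisotropic]). A nonzero element of M is therefore not a
    sum of two powers. For three, use that squares satisfy s^k = s and that
    every residue is a sum of two squares: choosing residues a and b with
    r - 1 = a^2 + b^2, what is left of r after subtracting the k-th powers of
    lifts of a^2 and b^2 has residue 1 and is a k-th power. *)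

(** * Waring numbers *)

Lemma sum_of_powersW (R : comNzRingType) k s t :
  (0 < k)%N -> (s <= t)%N -> sum_of_powers R k s -> sum_of_powers R k t.
Proof.
move=> k_gt0 /subnKC <- sumR; elim: (t - s)%N => [|u IHu].
  by rewrite addn0.
rewrite addnS => r; have [x xr] := IHu r.
exists (fun i => if unlift ord_max i is Some j then x j else 0).
rewrite big_ord_recr unlift_none /= expr0n eqn0Ngt k_gt0 addr0 -xr.
apply: eq_bigr => i _; congr (_ ^+ _).
have -> : widen_ord (leqnSn (s + u)) i = lift ord_max i.
  by apply: val_inj; rewrite /= /bump leqNgt ltn_ord.
by rewrite liftK.
Qed.

Lemma waring_numberS (R : comNzRingType) k s :
  (0 < k)%N -> sum_of_powers R k s.+1 -> ~ sum_of_powers R k s ->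
  waring_number R k s.+1.
Proof.
move=> k_gt0 sumR nsumR; split=> // t sumt; rewrite ltnNge; apply/negP=> le_ts.
exact/nsumR/(sum_of_powersW k_gt0 le_ts).
Qed.

Lemma sum_of_powers2 (R : comNzRingType) k :
  (forall r : R, exists x y, x ^+ k + y ^+ k = r) -> sum_of_powers R k 2.
Proof.
move=> h r; have [x [y <-]] := h r.
by exists (tnth [tuple x; y]); rewrite !big_ord_recl big_ord0 addr0.
Qed.

Lemma sum_of_powers3 (R : comNzRingType) k :
  (forall r : R, exists x y z, x ^+ k + y ^+ k + z ^+ k = r) ->
  sum_of_powers R k 3.
Proof.
move=> h r; have [x [y [z <-]]] := h r.
exists (tnth [tuple x; y; z]).
by rewrite !big_ord_recl big_ord0 addr0 /= addrA.
Qed.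

Lemma sum_of_powers1E (R : comNzRingType) k (r : R) :
  sum_of_powers R k 1 -> exists x, x ^+ k = r.
Proof.
by case/(_ r) => x <-; exists (x ord0); rewrite big_ord1.
Qed.

Lemma sum_of_powers2E (R : comNzRingType) k (r : R) :
  sum_of_powers R k 2 -> exists x y, x ^+ k + y ^+ k = r.
Proof.
case/(_ r) => x <-; exists (x ord0), (x (lift ord0 ord0)).
by rewrite !big_ord_recl big_ord0 addr0.
Qed.

(** * The field case *)

(** The nonzero elements are #|F| - 1 distinct roots of unity of that order,
    so one of them is primitive. *)
Lemma finField_prim_root (F : finFieldType) :
  exists w : F, #|F|.-1.-primitive_root w.
Proof.
have F_gt1 := finNzRing_gt1 F.
have : has #|F|.-1.-primitive_root (enum [pred x : F | x != 0]).
  apply: has_prim_root; rewrite ?enum_uniq //.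
    by rewrite -ltnS (ltn_predK F_gt1).
    apply/allP=> x; rewrite mem_enum inE unity_rootE => x_neq0.
    have := expf_card x; rewrite -[in X in X -> _](ltn_predK F_gt1) exprS.
    by move/(canRL (mulKf x_neq0)); rewrite mulVf // => ->.
  by rewrite -cardE -(cardC1 (0 : F)).
by case/hasP=> w _ ?; exists w.
Qed.

(** In terms of a generator w, the condition (w^i)^m = 1 says that k * m
    divides i * m, hence that k divides i. *)
Lemma finField_power (F : finFieldType) (k m : nat) (x : F) :
  #|F|.-1 = (k * m)%N -> x ^+ m = 1 -> exists y, y ^+ k = x.
Proof.
move=> Fkm xm1; have [w w_prim] := finField_prim_root F.
have m_gt0 : (0 < m)%N.
  by have := prim_order_gt0 w_prim; rewrite Fkm muln_gt0 => /andP[].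
have [i xE] : exists i : nat, x = w ^+ i.
  suff [i ->] : {i : 'I_#|F|.-1 | x = w ^+ i} by exists i.
  by apply: (prim_rootP w_prim); rewrite Fkm mulnC exprM xm1 expr1n.
move/eqP: xm1; rewrite xE -exprM -(prim_order_dvd w_prim) Fkm dvdn_pmul2r //.
by case/dvdnP=> j ->; exists (w ^+ j); rewrite exprM.
Qed.

(** The unit group has order k * 2(p-1). The summands (r + f r)/2 and
    (r - f r)/2, for f the Frobenius, satisfy x^(2p) = x^2, whereas a
    generator w does not satisfy w^(2(p-1)) = 1. *)
Lemma waring_finField (F : finFieldType) (p k : nat) :
  prime p -> k.*2 = p.+1 -> #|F| = (p ^ 2)%N -> waring_number F k 2.
Proof.
move=> p_prime kE cardF; have p_gt1 := prime_gt1 p_prime.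
have charF : p \in [pchar F] := card_finPcharP cardF p_prime.
have cardE : #|F|.-1 = (k * p.-1.*2)%N.
  by rewrite cardF -doubleMr doubleMl kE; lia.
have k_gt0 : (0 < k)%N by lia.
have two_neq0 : 2%:R != 0 :> F.
  rewrite -(dvdn_pcharf charF); apply/negP=> /(dvdn_leq (isT : 0 < 2)%N).
  lia.
have powerP (x : F) : x ^+ p.*2 = x ^+ 2 -> exists y, y ^+ k = x.
  have [->|x_neq0 xE] := eqVneq x 0.
    by exists 0; rewrite expr0n gtn_eqF.
  apply: (finField_power cardE); apply: (mulIf (expf_neq0 2 x_neq0)).
  rewrite mul1r -exprD -[RHS]xE; congr (_ ^+ _); lia.
apply: waring_numberS => //; last first.
  have [w w_prim] := finField_prim_root F.
  case/(@sum_of_powers1E _ _ w) => x xw.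
  have x_neq0 : x != 0.
    apply/eqP=> x0; have := prim_expr_order w_prim.
    rewrite -xw x0 expr0n gtn_eqF // expr0n gtn_eqF ?(prim_order_gt0 w_prim) //.
    by move/eqP; rewrite eq_sym oner_eq0.
  have : w ^+ p.-1.*2 = 1.
    apply: (mulIf x_neq0); rewrite mul1r -[RHS]expf_card.
    rewrite -xw -exprM -exprSr -cardE prednK //.
    exact: ltnW (finNzRing_gt1 F).
  move/eqP; rewrite -(prim_order_dvd w_prim) => /dvdn_leq.
  rewrite cardF; nia.
apply: sum_of_powers2 => r.
have [f fE] : exists f : {rmorphism F -> F}, forall x, f x = x ^+ p.
  by exists (pFrobenius_aut charF) => x; exact: pFrobenius_autE.
have ffr : f (f r) = r by rewrite !fE -exprM mulnn -cardF expf_card.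
have f2 : f (2%:R^-1) = 2%:R^-1 by rewrite fmorphV rmorph_nat.
have [x xE] : exists x, x ^+ k = (r + f r) / 2%:R.
  apply: powerP; rewrite -muln2 exprM -fE rmorphM rmorphD /= ffr f2.
  by rewrite [f r + r]addrC.
have [y yE] : exists y, y ^+ k = (r - f r) / 2%:R.
  apply: powerP; rewrite -muln2 exprM -fE rmorphM rmorphB /= ffr f2.
  by rewrite -opprB mulNr sqrrN.
by exists x, y; rewrite xE yE; field.
Qed.

Section IsField.

Variables (R : finComNzRingType) (R_field : is_field R).

(** A copy of R keyed by a proof that it is a field: the key lets the canonical
    field structure below depend on that proof. *)
Definition field_of of is_field R : Type := R.
Local Notation F := (field_of R_field).

Definition field_of_inv (x : R) : R := odflt 0 [pick y | y * x == 1].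

Fact field_of_mulVf x : x != 0 -> field_of_inv x * x = 1.
Proof.
move/R_field=> [y /eqP yx1]; rewrite /field_of_inv.
by case: pickP => [z /eqP|/(_ y)] //; rewrite yx1.
Qed.

Fact field_of_inv0 : field_of_inv 0 = 0.
Proof.
rewrite /field_of_inv; case: pickP => //= y.
by rewrite mulr0 eq_sym oner_eq0.
Qed.

HB.instance Definition _ := FinRing.ComNzRing.on F.
HB.instance Definition _ :=
  GRing.ComNzRing_isField.Build F field_of_mulVf field_of_inv0.

Lemma waring_is_field p k :
  prime p -> k.*2 = p.+1 -> #|R| = (p ^ 2)%N -> waring_number R k 2.
Proof. exact: (@waring_finField F). Qed.

End IsField.

(** * Local rings of order p^2 that are not fields *)

Lemma proper_ideal_sub_maximal (R : finComNzRingType) (I : {set R}) :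
  idealr_closed I -> exists2 M : {set R}, maximal_ideal M & I \subset M.
Proof.
pose idealb (J : {set R}) :=
  [&& 0 \in J, 1 \notin J
    & [forall a, forall u in J, forall v in J, a * u + v \in J]].
have idealP (J : {set R}) : reflect (idealr_closed J) (idealb J).
  apply: (iffP and3P) => -[J0 J1 JD]; split=> //.
    by move=> a u v Ju Jv; exact: (forall_inP (forall_inP (forallP JD a) u Ju)).
  apply/forallP=> a; apply/forall_inP=> u Ju; apply/forall_inP=> v.
  exact: JD.
move=> /idealP /maxset_exists[M /maxsetP[/idealP M_ideal M_max] sIM].
by exists M => //; split=> // J /idealP; exact: M_max.
Qed.

(** The multiples of a nonunit x form a proper ideal, which lies in a maximal
    ideal; by uniqueness that ideal is M, so x belongs to M. *)
Lemma local_ring_units (R : finComNzRingType) :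
  local_ring R ->
  exists2 M : {set R}, idealr_closed M
    & forall x, x \notin M -> exists y, y * x = 1.
Proof.
case=> M [[M_ideal _] M_uniq]; exists M => // x.
have [/existsP[y /eqP yx1] _|] := boolP [exists y, y * x == 1].
  by exists y.
rewrite negb_exists => /forallP x_nunit /negP[].
have [|J J_max /subsetP sxJ] :=
  @proper_ideal_sub_maximal R [set y * x | y in R].
  split; first by apply/imsetP; exists 0; rewrite ?mul0r.
    by apply/imsetP=> -[y _ /esym/eqP]; exact/negP.
  move=> a _ _ /imsetP[y _ ->] /imsetP[z _ ->].
  by apply/imsetP; exists (a * y + z); rewrite // mulrDl mulrA.
rewrite (M_uniq J J_max); apply: sxJ.
by apply/imsetP; exists 1; rewrite ?mul1r.
Qed.

Section Residue.

Variables (R : finComNzRingType) (p : nat) (M : {set R}).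
Hypotheses (p_prime : prime p) (R_card : #|R| = (p ^ 2)%N).
Hypothesis M_ideal : idealr_closed M.
Hypothesis M_unit : forall x, x \notin M -> exists y, y * x = 1.
Hypothesis R_nfield : ~ is_field R.

Let M0 : 0 \in M. Proof. by case: M_ideal. Qed.
Let M1 : 1 \notin M. Proof. by case: M_ideal. Qed.
Let MD x y : x \in M -> y \in M -> x + y \in M.
Proof.
by case: M_ideal => _ _ M_lin Mx My; rewrite -[x]mul1r; exact: M_lin.
Qed.
Let Mml a x : x \in M -> a * x \in M.
Proof.
by case: M_ideal => _ _ M_lin Mx; rewrite -[_ * _]addr0; exact: M_lin.
Qed.
Let MN x : x \in M -> - x \in M.
Proof. by rewrite -mulN1r; exact: Mml. Qed.
Let MB x y : x \in M -> y \in M -> x - y \in M.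
Proof. by move=> Mx /MN; exact: MD. Qed.

Lemma maximal_ideal_neq0 : exists2 x, x \in M & x != 0.
Proof.
have [/existsP[x /andP[]]|M_eq0] := boolP [exists x, (x \in M) && (x != 0)].
  by exists x.
case: R_nfield => x x_neq0; apply: M_unit; apply: contra M_eq0 => Mx.
by apply/existsP; exists x; rewrite Mx.
Qed.

(** By Lagrange #|M| is 1, p or p^2, and M is neither 0 nor R. *)
Lemma card_maximal_ideal : #|M| = p.
Proof.
have M_group : group_set M.
  by apply/group_setP; split=> [|x y]; [exact: M0 | exact: MD].
have := cardSg (subsetT (group M_group)).
rewrite cardsT R_card => /dvdn_pfactor-/(_ p_prime)[[|[|[|//]]] _ /= ME].
- have [x Mx /negP[]] := maximal_ideal_neq0.
  move/eqP: ME => /cards1P[y ME]; move: Mx M0.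
  by rewrite ME !inE => /eqP-> /eqP->.
- by rewrite ME expn1.
have : M == setT by rewrite eqEcard subsetT cardsT R_card ME leqnn.
by move/eqP=> MT; move: M1; rewrite MT inE.
Qed.

(** The square of p%:R is #|R|%:R = 0, so p%:R is not a unit. *)
Lemma prime_in_maximal_ideal : p%:R \in M.
Proof.
apply/negPn/negP=> /M_unit[y yp1].
have R0 : (p ^ 2)%:R = 0 :> R.
  have := expg_cardG (in_setT (1 : R)).
  by rewrite cardsT R_card FinRing.zmodXgE FinRing.zmod1gE.
have /eqP[] := oner_neq0 R.
by rewrite -(expr1n _ 2) -yp1 exprMn -natrX R0 mulr0.
Qed.

Lemma nat_in_maximal_ideal n : (n%:R \in M) = (p %| n)%N.
Proof.
apply/idP/idP=> [Mn|/dvdnP[q ->]]; last first.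
  by rewrite natrM; apply: Mml; exact: prime_in_maximal_ideal.
apply: contraLR Mn; rewrite -prime_coprime // coprime_sym => co_np.
have n_gt0 : (0 < n)%N.
  rewrite lt0n; apply: contraTneq co_np => ->.
  by rewrite /coprime gcd0n gtn_eqF ?prime_gt1.
have [u v uv _] := egcdnP p n_gt0; apply: contra M1 => Mn.
have -> : 1 = u%:R * n%:R - v%:R * p%:R :> R.
  by rewrite -!natrM uv (eqP co_np) natrD addrAC subrr add0r.
by apply: MB; apply: Mml => //; exact: prime_in_maximal_ideal.
Qed.

Lemma natB_in_maximal_ideal (m n : nat) :
  (m%:R - n%:R \in M) = (m%:R == n%:R :> 'F_p).
Proof.
wlog le_nm : m n / (n <= m)%N.
  move=> IH; have [/IH //|/ltnW/IH nm] := leqP n m.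
  rewrite eq_sym -nm -opprB.
  by apply/idP/idP=> /MN; rewrite ?opprK.
rewrite -natrB // nat_in_maximal_ideal -subr_eq0 -natrB //.
by rewrite (dvdn_pcharf (pchar_Fp p_prime)).
Qed.

Lemma ord_in_maximal_ideal (i j : 'I_p) :
  (i : nat)%:R - (j : nat)%:R \in M -> i = j.
Proof.
rewrite natB_in_maximal_ideal => /eqP/(congr1 (@nat_of_ord _)).
by rewrite !val_Fp_nat // !modn_small // => /val_inj.
Qed.

(** The p cosets i + M, for i < p, are disjoint and have p elements each, so
    they exhaust R. *)
Lemma nat_mod_maximal_ideal x : exists n : nat, x - n%:R \in M.
Proof.
pose f (u : 'I_p * R) := (u.1 : nat)%:R + u.2.
pose D := [set u : 'I_p * R | u.2 \in M].
have f_inj : {in D &, injective f}.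
  move=> [i x1] [j y1]; rewrite !inE /f /= => Mx My ixjy.
  have ij : i = j.
    have : (i : nat)%:R - (j : nat)%:R \in M.
      have -> : (i : nat)%:R - (j : nat)%:R = y1 - x1 :> R.
        by apply/eqP; rewrite subr_eq addrAC eq_sym subr_eq addrC ixjy addrC.
      exact: MB.
    exact: ord_in_maximal_ideal.
  by move: ixjy; rewrite ij => /addrI->.
have DE : D = setX setT M by apply/setP=> -[i y]; rewrite !inE.
have : f @: D == setT.
  rewrite eqEcard subsetT card_in_imset // DE cardsX !cardsT card_ord.
  by rewrite card_maximal_ideal R_card mulnn leqnn.
move/eqP/setP/(_ x); rewrite inE => /imsetP[[i y]].
by rewrite inE => My ->; exists i; rewrite /f addrAC subrr add0r.
Qed.

(** Every class modulo M contains a natural number, which is unique modulo p;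
    this identifies R / M with the prime field. *)
Lemma residue_map :
  exists pi : {rmorphism R -> 'F_p}, forall x, (x \in M) = (pi x == 0).
Proof.
have rep x : {n : nat | x - n%:R \in M} := sigW (nat_mod_maximal_ideal x).
pose pi x : 'F_p := (sval (rep x))%:R.
have piE x n : x - n%:R \in M -> pi x = n%:R.
  move=> Mxn; apply/eqP; rewrite /pi -natB_in_maximal_ideal.
  have -> : (sval (rep x))%:R - n%:R = x - n%:R - (x - (sval (rep x))%:R).
    by ring.
  by apply: MB => //; exact: svalP (rep x).
have pi_nat n : pi n%:R = n%:R by apply: piE; rewrite subrr.
have pi_rep x : exists2 n : nat, x - n%:R \in M & pi x = n%:R.
  by exists (sval (rep x)); first exact: svalP (rep x).
have piD : GRing.nmod_morphism pi.
  split=> [|x y]; first exact: (pi_nat 0).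
  have [m xm ->] := pi_rep x; have [n yn ->] := pi_rep y.
  rewrite -natrD; apply: piE; rewrite natrD.
  have -> : x + y - (m%:R + n%:R) = x - m%:R + (y - n%:R) by ring.
  exact: MD.
have piM : GRing.monoid_morphism pi.
  split=> [|x y]; first exact: (pi_nat 1).
  have [m xm ->] := pi_rep x; have [n yn ->] := pi_rep y.
  rewrite -natrM; apply: piE; rewrite natrM.
  have -> : x * y - m%:R * n%:R = y * (x - m%:R) + m%:R * (y - n%:R) by ring.
  by apply: MD; apply: Mml.
pose pi_D := GRing.isNmodMorphism.Build R 'F_p pi piD.
pose pi_M := GRing.isMonoidMorphism.Build R 'F_p pi piM.
pose pi_rmorph : {rmorphism R -> 'F_p} := HB.pack pi pi_D pi_M.
exists pi_rmorph => x; apply/idP/eqP => /= [Mx | pix0].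
  by apply: (piE x 0); rewrite subr0.
have [n xn pixn] := pi_rep x; rewrite -[x](subrK n%:R); apply: MD => //.
by rewrite -[_%:R]subr0 (natB_in_maximal_ideal _ 0) -pixn pix0.
Qed.

(** If z is a nonzero element of M, the p products i * z with i < p are
    distinct, so they are the elements of M, and it suffices to see that
    z * z = 0. Write z * z = n * z with n < p: then z - n kills z, so it lies
    in M, hence n lies in M and n = 0. *)
Lemma maximal_ideal_sqr0 x y : x \in M -> y \in M -> x * y = 0.
Proof.
have [z Mz z_neq0] := maximal_ideal_neq0.
have unit_inj u : u \notin M -> u * z != 0.
  case/M_unit=> v vu1; apply: contraNneq z_neq0 => uz0.
  by rewrite -[z]mul1r -vu1 -mulrA uz0 mulr0.
have M_line u : u \in M -> exists2 n : nat, (n < p)%N & u = n%:R * z.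
  pose f (i : 'I_p) := (i : nat)%:R * z.
  have f_inj : injective f.
    move=> i j /eqP; rewrite -subr_eq0 -mulrBl => /eqP ij.
    have : (i : nat)%:R - (j : nat)%:R \in M.
      by apply: contraT => /unit_inj; rewrite ij eqxx.
    exact: ord_in_maximal_ideal.
  have : f @: setT == M.
    rewrite eqEcard card_imset // cardsT card_ord card_maximal_ideal leqnn.
    rewrite andbT.
    by apply/subsetP=> _ /imsetP[i _ ->]; exact: Mml.
  move/eqP/setP/(_ u) => <- /imsetP[i _ ->].
  by exists i => //; exact: ltn_ord.
have zz0 : z * z = 0.
  have [n n_ltp zn] := M_line _ (Mml z Mz).
  have Mzn : z - n%:R \in M.
    by apply: contraT => /unit_inj; rewrite mulrBl zn subrr eqxx.
  have := MB Mz Mzn; rewrite subKr nat_in_maximal_ideal.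
  have [n0 | n_gt0 /(dvdn_leq n_gt0)] := posnP n; last by rewrite leqNgt n_ltp.
  by rewrite zn n0 mul0r.
by move=> /M_line[m _ ->] /M_line[n _ ->]; rewrite mulrACA zz0 mulr0.
Qed.

End Residue.

(** * Lifting powers from the residue field *)

(** The binomial formula stops at order one: this is the Taylor expansion
    behind the lifting of k-th powers. *)
Lemma exprD_sqr0 (A : comNzRingType) (y m : A) n :
  m * m = 0 -> (y + m) ^+ n.+1 = y ^+ n.+1 + n.+1%:R * y ^+ n * m.
Proof.
move=> mm0; elim: n => [|n IHn]; first by rewrite !expr1 expr0 !mul1r.
rewrite exprSr IHn; set c := n.+1%:R.
have -> : n.+2%:R = c + 1 by exact: mulrSr.
transitivity (y ^+ n.+1 * y + (c * (y ^+ n * y) + y ^+ n.+1) * m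
              + c * y ^+ n * (m * m)); first by ring.
by rewrite mm0 mulr0 addr0 -!exprSr; ring.
Qed.

(** The set S of squares has more than #|F| / 2 elements, since squaring is at
    most two-to-one and 0 has a single square root. Hence S meets a - S. *)
Lemma finField_two_squares (F : finFieldType) (a : F) :
  exists x y, x ^+ 2 + y ^+ 2 = a.
Proof.
pose S : {set F} := [set x ^+ 2 | x : F].
have S0 : 0 \in S by apply/imsetP; exists 0; rewrite ?expr0n.
have card_fiber s :
  s \in S -> (#|[set x : F | x ^+ 2 == s]| <= 2 - (s == 0%R))%N.
  case/imsetP=> x _ ->; have [->|x_neq0] := eqVneq x 0.
    rewrite expr0n eqxx.
    apply: (@leq_trans #|[set (0 : F)]|); last by rewrite cards1.
    by apply/subset_leq_card/subsetP=> y; rewrite !inE expf_eq0.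
  rewrite expf_eq0 /= (negbTE x_neq0) subn0.
  apply: leq_trans (_ : #|[set x; - x]| <= 2)%N; last first.
    by rewrite cards2; case: eqP.
  by apply/subset_leq_card/subsetP=> y; rewrite !inE eqf_sqr.
have card_S : (#|F| < #|S|.*2)%N.
  have -> : #|F| = (\sum_(s in S) #|[set x : F | x ^+ 2 == s]|)%N.
    rewrite -sum1_card (partition_big (fun x : F => x ^+ 2) (mem S)) /=.
      apply: eq_bigr => s _; rewrite -sum1_card.
      by apply: eq_bigl => x; rewrite inE.
    by move=> x _; exact: imset_f.
  apply: (@leq_ltn_trans (\sum_(s in S) (2 - (s == 0%R)))%N).
    by apply: leq_sum => s; exact: card_fiber.
  rewrite (bigD1 0) //= eqxx.
  under eq_bigr => s /andP[_ /negbTE->] do rewrite subn0.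
  rewrite sum_nat_cond_const (cardD1 0 S) S0.
  rewrite [X in (_ + X * _)%N](_ : _ = #|[predD1 S & 0]|).
    by rewrite -muln2 mulnDl ltn_add2r.
  by apply: eq_card => s; rewrite !inE andbC.
pose T : {set F} := [set a - s | s in S].
have card_T : #|T| = #|S| by apply: card_imset => s t /addrI/oppr_inj.
have [s /andP[]] : exists s, (s \in S) && (s \in T).
  apply/existsP; apply: contraLR card_S => /existsPn ST0; rewrite -leqNgt.
  rewrite -addnn -{2}card_T -cardsUI (_ : S :&: T = set0).
    by rewrite cards0 addn0 max_card.
  by apply/setP=> s; rewrite !inE; exact/negbTE.
case/imsetP=> x _ -> /imsetP[_ /imsetP[y _ ->] xE].
by exists x, y; rewrite xE subrK.
Qed.

Lemma Fp_power_sqr p k (a : 'F_p) :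
  prime p -> k.*2 = p.+1 -> (a ^+ k) ^+ 2 = a ^+ 2.
Proof.
move=> p_prime kE; rewrite -exprM muln2 kE exprS.
have -> : a ^+ p = a by have := expf_card a; rewrite (card_Fp p_prime).
by rewrite expr2.
Qed.

Lemma Fp_sqr_power p k (a : 'F_p) :
  prime p -> k.*2 = p.+1 -> (a ^+ 2) ^+ k = a ^+ 2.
Proof. by move=> ? ?; rewrite exprAC Fp_power_sqr. Qed.

(** As (a^k)^2 = a^2, either a^k = a or a^k = -a, and then (-a)^k = a. *)
Lemma Fp_odd_power p k (a : 'F_p) :
  prime p -> k.*2 = p.+1 -> odd k -> exists b, b ^+ k = a.
Proof.
move=> p_prime kE k_odd; have := Fp_power_sqr a p_prime kE.
move/eqP; rewrite eqf_sqr => /orP[]/eqP aE; first by exists a.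
by exists (- a); rewrite exprNn -signr_odd k_odd aE expr1 mulN1r opprK.
Qed.

(** From a^k = -b^k one gets a^2 = b^2 by squaring, so a = b or a = -b, and
    a^k = b^k because k is even. Thus 2 b^k = 0. *)
Lemma Fp_even_power_anisotropic p k (a b : 'F_p) :
  prime p -> k.*2 = p.+1 -> ~~ odd k -> a ^+ k + b ^+ k = 0 -> a = 0 /\ b = 0.
Proof.
move=> p_prime kE k_even ab0; have p_odd : odd p by lia.
have k_gt0 : (0 < k)%N by lia.
have abk : a ^+ k = b ^+ k.
  have : a ^+ 2 = b ^+ 2.
    rewrite -(Fp_power_sqr a p_prime kE) -(Fp_power_sqr b p_prime kE).
    by move/eqP: ab0; rewrite addr_eq0 => /eqP->; rewrite sqrrN.
  move/eqP; rewrite eqf_sqr => /orP[]/eqP-> //.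
  by rewrite exprNn -signr_odd (negbTE k_even) mul1r.
have two_neq0 : 2%:R != 0 :> 'F_p.
  rewrite -(dvdn_pcharf (pchar_Fp p_prime)).
  by apply/negP=> /(dvdn_leq (isT : 0 < 2)%N); have := prime_gt1 p_prime; lia.
move/eqP: ab0; rewrite abk -mulr2n -mulr_natl mulf_eq0 (negbTE two_neq0) /=.
rewrite expf_eq0 k_gt0 /= => /eqP b0; split=> //.
by apply/eqP; move/eqP: abk; rewrite b0 expr0n gtn_eqF // expf_eq0 k_gt0.
Qed.

(** The residue map pi carries all that the Waring numbers depend on: units
    and k-th powers of units are detected by it, and k-th powers of elements of
    its kernel vanish. The element m witnesses the lower bounds. *)
Section NonField.

Variables (R : finComNzRingType) (p k : nat) (pi : {rmorphism R -> 'F_p}).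
Hypotheses (p_prime : prime p) (p_gt2 : (2 < p)%N) (kE : k.*2 = p.+1).
Hypothesis pi_unit : forall x, pi x != 0 -> exists y, y * x = 1.
Hypothesis pi_sqr0 : forall x y, pi x = 0 -> pi y = 0 -> x * y = 0.
Variable m : R.
Hypotheses (m_neq0 : m != 0) (pi_m : pi m = 0).

Let k_gt1 : (1 < k)%N. Proof. by move: p_gt2; lia. Qed.
Let k_gt0 : (0 < k)%N. Proof. exact: ltnW. Qed.
Let k_ltp : (k < p)%N. Proof. by move: p_gt2; lia. Qed.

Lemma power_kernel x : pi x = 0 -> x ^+ k = 0.
Proof.
move=> pix0; rewrite -(subnKC k_gt1) exprD expr2.
by rewrite (pi_sqr0 pix0 pix0) mul0r.
Qed.

(** Let y be a lift of b. By [exprD_sqr0], (y + c m)^k = r for m = r - y^k and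
    c the inverse of k y^(k-1), which is a unit since 0 < k < p and b <> 0. *)
Lemma power_lift (r : R) (b : 'F_p) :
  b != 0 -> b ^+ k = pi r -> exists x, x ^+ k = r.
Proof.
move=> b_neq0 br; pose y : R := (b : nat)%:R.
have piy : pi y = b by rewrite rmorph_nat natr_Zp.
have [|c c1] := @pi_unit (k%:R * y ^+ k.-1).
  rewrite rmorphM rmorphXn rmorph_nat /= piy mulf_neq0 ?expf_neq0 //.
  rewrite -(dvdn_pcharf (pchar_Fp p_prime)).
  by apply/negP=> /(dvdn_leq k_gt0); rewrite leqNgt k_ltp.
have pim : pi (c * (r - y ^+ k)) = 0.
  by rewrite rmorphM rmorphB rmorphXn /= piy br subrr mulr0.
exists (y + c * (r - y ^+ k)).
have := exprD_sqr0 y k.-1 (pi_sqr0 pim pim); rewrite prednK // => ->.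
by rewrite mulrA [_ * c]mulrC c1 mul1r addrC subrK.
Qed.

Lemma kernel_not_power : ~ exists x, x ^+ k = m.
Proof.
case=> x xm; have /eqP[] := m_neq0; rewrite -xm; apply: power_kernel.
have : pi x ^+ k == 0 by rewrite -rmorphXn /= xm pi_m.
by rewrite expf_eq0 k_gt0 => /eqP.
Qed.

Lemma waring_nonfield_odd : odd k -> waring_number R k 2.
Proof.
move=> k_odd; apply: waring_numberS => //; last first.
  by move/(@sum_of_powers1E _ _ m)/kernel_not_power.
have unit_power r : pi r != 0 -> exists x, x ^+ k = r.
  have [b bE] := Fp_odd_power (pi r) p_prime kE k_odd; rewrite -bE => bk_neq0.
  apply: power_lift bE; apply: contraNneq bk_neq0 => ->.
  by rewrite expr0n gtn_eqF.
apply: sum_of_powers2 => r; have [pir0 | /unit_power[x xr]] := eqVneq (pi r) 0.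
  have [|x xr] := unit_power (r - 1).
    by rewrite rmorphB rmorph1 pir0 sub0r oppr_eq0 oner_eq0.
  by exists x, 1; rewrite xr expr1n subrK.
by exists x, 0; rewrite xr expr0n gtn_eqF ?addr0.
Qed.

Lemma waring_nonfield_even : ~~ odd k -> waring_number R k 3.
Proof.
move=> k_even; apply: waring_numberS => //.
  apply: sum_of_powers3 => r.
  have [a [b abr]] := finField_two_squares (pi r - 1).
  pose x : R := (a : nat)%:R ^+ 2; pose y : R := (b : nat)%:R ^+ 2.
  (* As squares are their own k-th powers, the remainder has residue 1. *)
  have [|z zr] := @power_lift (r - (x ^+ k + y ^+ k)) 1 (oner_neq0 _).
    rewrite expr1n rmorphB rmorphD !rmorphXn !rmorph_nat /= !natr_Zp.
    by rewrite !Fp_sqr_power // abr subKr.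
  by exists x, y, z; rewrite zr addrC subrK.
move/(@sum_of_powers2E _ _ m)=> [x [y xym]].
have [|/power_kernel xk0 /power_kernel yk0] :=
  @Fp_even_power_anisotropic p k (pi x) (pi y) p_prime kE k_even.
  by rewrite -!rmorphXn -rmorphD /= xym.
by have /eqP[] := m_neq0; rewrite -xym xk0 yk0 addr0.
Qed.

End NonField.

Theorem corollary7p9 (R : finComNzRingType) (p : nat)
    (p_prime : prime p) (p_odd : odd p)
    (R_local : local_ring R) (R_card : #|R| = (p ^ 2)%N) :
  (is_field R -> waring_number R ((p + 1) %/ 2) 2) /\
  (~ is_field R ->
     (p = 1 %[mod 4] -> waring_number R ((p + 1) %/ 2) 2) /\
     (p = 3 %[mod 4] -> waring_number R ((p + 1) %/ 2) 3)).
Proof.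
have p_gt2 : (2 < p)%N by have := prime_gt1 p_prime; lia.
have kE : ((p + 1) %/ 2).*2 = p.+1 by lia.
split=> [R_field | R_nfield]; first exact: (waring_is_field R_field p_prime).
have [M M_ideal M_unit] := local_ring_units R_local.
have [m Mm m_neq0] := maximal_ideal_neq0 M_unit R_nfield.
have [pi piE] := residue_map p_prime R_card M_ideal M_unit R_nfield.
have pi_unit x : pi x != 0 -> exists y, y * x = 1.
  by rewrite -piE; exact: M_unit.
have pi_sqr0 x y : pi x = 0 -> pi y = 0 -> x * y = 0.
  move=> /eqP; rewrite -piE => Mx /eqP; rewrite -piE.
  exact: (maximal_ideal_sqr0 p_prime R_card M_ideal M_unit R_nfield).
have pi_m : pi m = 0 by apply/eqP; rewrite -piE.
split=> p_mod.
  apply: (waring_nonfield_odd p_prime p_gt2 kE pi_unit pi_sqr0 m_neq0 pi_m).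
  by lia.
apply: (waring_nonfield_even p_prime p_gt2 kE pi_unit pi_sqr0 m_neq0 pi_m).
by lia.
Qed.
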